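(* Let $n\ge p$, $\nu>0$, $\Psi\in\mathbb R^{n\times p}$, and define for $M\in\mathcal V_{n,p}$, $V\in\mathcal V_{p,p}$, $\boldsymbol d\in\mathbb R_+^p$ (with $D=\mathrm{diag}(\boldsymbol d)$) $$g(M,\boldsymbol d,V;\nu,\Psi)=\frac{\mathrm{etr}(\nu VDM^T\Psi)}{\left[{}_0F_1\!\left(\tfrac n2,\tfrac{D^2}{4}\right)\right]^\nu}.$$ (a) If $\|\Psi\|_2<1$, then $\int_{\mathcal V_{n,p}}\int_{\mathcal V_{p,p}}\int_{\mathbb R_+^p} g(M,\boldsymbol d,V;\nu,\Psi)\,d\boldsymbol d\,d\mu(V)\,d\mu(M)<\infty$. (b) If $\|\Psi\|_2>1$, then this integral equals $+\infty$.
   Context: $\mathcal V_{n,p}=\{X\in\mathbb R^{n\times p}:X^TX=I_p\}$; $\mu$ denotes the normalized Haar probability measure on $\mathcal V_{n,p}$ (resp. on $\mathcal V_{p,p}=O(p)$); $d\boldsymbol d$ is Lebesgue measure on $\mathbb R_+^p=(0,\infty)^p$. $\|\cdot\|_2$ is the spectral norm, $\mathrm{etr}(A)=\exp(\mathrm{tr}A)$. For diagonal $D$ with diagonal $\boldsymbol d$, ${}_0F_1\!\left(\tfrac n2,\tfrac{D^2}{4}\right)=\int_{\mathcal V_{n,p}}\exp\big(\sum_j d_jX_{jj}\big)[dX]$. *)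

(* Defs.v *)
From HB Require Import structures.
From mathcomp Require Import all_boot all_order all_algebra.
From mathcomp Require Import all_classical all_reals all_analysis.
Set Implicit Arguments.
Unset Strict Implicit.
Unset Printing Implicit Defensive.
Import Order.TTheory GRing.Theory Num.Theory.
Import numFieldNormedType.Exports.
Local Open Scope classical_set_scope.
Local Open Scope ring_scope.

(* Real matrices as a measurable space: the sigma-algebra generated by
   the entry maps (each entry with the Borel sigma-algebra of R), i.e.
   the Borel sigma-algebra of R^(m x n).                               *)
Definition mxm (R : realType) (m n : nat) : Type := 'M[R]_(m, n).

HB.instance Definition _ (R : realType) m n :=
  Pointed.on (mxm R m n).

Definition mx_display : measure_display -> measure_display.
Proof. exact. Qed.

Section mx_measurable.
Context (R : realType) (m n : nat).

Definition mx_entry (k : 'I_(m * n)) (X : mxm R m n) : R := mxvec X 0 k.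

Let mx_set0 : g_sigma_preimage mx_entry set0.
Proof. exact: sigma_algebra0. Qed.
Let mx_setC A : g_sigma_preimage mx_entry A -> g_sigma_preimage mx_entry (~` A).
Proof. exact: sigma_algebraC. Qed.
Let mx_bigcup (F : _^nat) : (forall i, g_sigma_preimage mx_entry (F i)) ->
  g_sigma_preimage mx_entry (\bigcup_i (F i)).
Proof. exact: sigma_algebra_bigcup. Qed.

HB.instance Definition _ := @isMeasurable.Build (mx_display default_measure_display)
  (mxm R m n) (g_sigma_preimage mx_entry) mx_set0 mx_setC mx_bigcup.
End mx_measurable.

Definition stiefel (R : realType) (n p : nat) : set (mxm R n p) :=
  [set X : mxm R n p | (X : 'M[R]_(n, p))^T *m X = 1%:M].

Definition orthogonal_mx (R : realType) (n : nat) (Q : 'M[R]_n) : Prop :=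
  Q^T *m Q = 1%:M.

(* mu is the normalized Haar probability measure on V_{n,p}: a probability
   measure on R^{n x p} carried by V_{n,p} and invariant under the left action
   X |-> Q X of O(n).  (Such a measure exists and is unique; for p = n this is
   the Haar probability measure of the compact group O(n).) *)
Definition is_haar_stiefel (R : realType) (n p : nat)
    (mu : probability (mxm R n p) R) : Prop :=
  mu (@stiefel R n p) = 1%E /\
  forall (Q : 'M[R]_n), orthogonal_mx Q ->
    forall A : set (mxm R n p), measurable A ->
      mu ((fun X : mxm R n p => (Q *m (X : 'M[R]_(n, p))) : mxm R n p) @^-1` A)
      = mu A.

Definition vnorm2 (R : realType) (k : nat) (v : 'cV[R]_k) : R :=
  Num.sqrt (\sum_(i < k) v i 0 ^+ 2).

Definition spec_norm (R : realType) (n p : nat) (A : 'M[R]_(n, p)) : R :=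
  sup [set vnorm2 (A *m x) | x in [set x : 'cV[R]_p | vnorm2 x = 1]].

(* Lebesgue integral over R_+^p = (0, +oo)^p of a nonnegative function,
   written as the iterated integral over the coordinates (Tonelli). *)
Fixpoint int_Rpos (R : realType) (k : nat) : (k.-tuple R -> \bar R) -> \bar R :=
  match k return (k.-tuple R -> \bar R) -> \bar R with
  | 0 => fun F => F [tuple]
  | k'.+1 => fun F =>
      (\int[@lebesgue_measure R]_(x in [set x : R | (0 < x)%R])
          int_Rpos (fun t : k'.-tuple R => F (cons_tuple x t)))%E
  end.

Definition diagd (R : realType) (p : nat) (d : p.-tuple R) : 'M[R]_p :=
  diag_mx (\row_j tnth d j).

(* 0F1(n/2, D^2/4) = \int_{V_{n,p}} exp(sum_j d_j X_jj) [dX] *)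
Definition hyp0F1 (R : realType) (n p : nat) (mu : probability (mxm R n p) R)
    (d : p.-tuple R) : R :=
  Rintegral mu (@stiefel R n p)
    (fun X : mxm R n p =>
       expR (\sum_(i < n) \sum_(j < p)
               if (i == j :> nat) then tnth d j * (X : 'M[R]_(n, p)) i j else 0)).

Definition gdens (R : realType) (n p : nat) (mu : probability (mxm R n p) R)
    (nu : R) (Psi : 'M[R]_(n, p))
    (M : 'M[R]_(n, p)) (d : p.-tuple R) (V : 'M[R]_p) : R :=
  expR (\tr (nu *: (V *m diagd d *m M^T *m Psi))) / (hyp0F1 mu d `^ nu).

Definition total_integral (R : realType) (n p : nat)
    (muM : probability (mxm R n p) R) (muV : probability (mxm R p p) R)
    (nu : R) (Psi : 'M[R]_(n, p)) : \bar R :=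
  (\int[muM]_(M in @stiefel R n p)
     \int[muV]_(V in @stiefel R p p)
        int_Rpos (fun d : p.-tuple R => (gdens muM nu Psi M d V)%:E))%E.

(* Main.v *)
(* Since each X_jj <= 1 on the Stiefel manifold, 0F1 is at most
   exp(\sum_j d_j).  Conversely, the neighbourhood X_jj > 1 - e of the matrix
   pid_mx p has positive Haar measure c, so 0F1 is at least
   c exp((1 - e) \sum_j d_j).  With N := M^T Psi V, the trace in g is
   nu \sum_j d_j N_jj.
   If |Psi| < 1 then N_jj <= |Psi|, and for small e the density g is
   dominated, uniformly in M and V, by a decaying exponential in \sum_j d_j.
   If |Psi| > 1, take a unit vector v with |Psi v| > 1; when the first columns
   of M and V are close to Psi v / |Psi v| and v, one has N_11 >= 1, the integral
   over d_1 diverges, and such pairs (M, V) form a set of positive measure. *)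
Require Import Defs.
From HB Require Import structures.
From mathcomp Require Import all_boot all_order all_algebra.
From mathcomp Require Import all_classical all_reals all_analysis.
From mathcomp Require Import measurable_realfun ring lra.
Set Implicit Arguments.
Unset Strict Implicit.
Unset Printing Implicit Defensive.
Import Order.TTheory GRing.Theory Num.Theory.
Local Open Scope classical_set_scope.
Local Open Scope ring_scope.


(** * Integrals *)
Section integral_bounds.
Context d (T : measurableType d) (R : realType) (mu : measure T R).
Implicit Types (D E : set T) (f g : T -> \bar R).
Local Open Scope ereal_scope.

(* Unlike [ge0_le_integral], this needs no measurability: the integral of a
   nonnegative function is a supremum over the simple functions below it. *)
Lemma ge0_le_integral_nomeas D f g : (forall x, D x -> 0 <= f x) ->
  (forall x, D x -> f x <= g x) ->
  \int[mu]_(x in D) f x <= \int[mu]_(x in D) g x.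
Proof.
move=> f0 fg; have g0 x : D x -> 0 <= g x.
  by move=> Dx; exact: le_trans (f0 _ Dx) (fg _ Dx).
rewrite (ge0_integralE mu f0) (ge0_integralE mu g0); apply: le_ereal_sup.
move=> _ [h hf <-]; exists h => //= x; apply: le_trans (hf x) _.
rewrite /patch; case: ifP => // /[!inE] Dx; exact: fg.
Qed.

(** The constant [k] is an extended real so that divergence can be propagated outwards with
    [k = +oo]. *)
Lemma cst_mul_measure_le_integral D E f (k : \bar R) : measurable E ->
  E `<=` D -> (forall x, D x -> 0 <= f x) -> 0 <= k ->
  (forall x, E x -> k <= f x) -> k * mu E <= \int[mu]_(x in D) f x.
Proof.
move=> mE ED f0 k0 kf; rewrite -(integral_cst mu mE).
rewrite integral_mkcond [leRHS]integral_mkcond; apply: ge0_le_integral_nomeas.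
  by move=> x _; rewrite /patch; case: ifP.
move=> x _; rewrite /patch; case: ifPn => [/[!inE] Ex|_].
  by rewrite mem_set; [exact: kf|exact: ED].
by case: ifPn => // /[!inE] Dx; exact: f0.
Qed.

Lemma integral_le_cst D f (k : \bar R) : (forall x, D x -> 0 <= f x) ->
  0 <= k -> (forall x, D x -> f x <= k) ->
  \int[mu]_(x in D) f x <= k * mu setT.
Proof.
move=> f0 k0 fk; rewrite -(integral_cst mu measurableT).
rewrite integral_mkcond; apply: ge0_le_integral_nomeas => x _.
  by rewrite /patch; case: ifPn => // /[!inE] Dx; exact: f0.
by rewrite /patch; case: ifPn => // /[!inE] Dx; exact: fk.
Qed.

End integral_bounds.

(** * Exponential integrals over the positive orthant *)

Section int_Rpos_bounds.
Context (R : realType).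
Local Open Scope ereal_scope.

Lemma int_Rpos_ge0 k (F : k.-tuple R -> \bar R) :
  (forall t, 0 <= F t) -> 0 <= int_Rpos F.
Proof.
elim: k F => [|k IH] F F0 //=.
by apply: integral_ge0 => x _; exact: IH.
Qed.

Lemma le_int_Rpos k (F G : k.-tuple R -> \bar R) : (forall t, 0 <= F t) ->
  (forall t, (forall i, 0 < tnth t i)%R -> F t <= G t) ->
  int_Rpos F <= int_Rpos G.
Proof.
elim: k F G => [|k IH] F G F0 FG /=; first by apply: FG => -[].
apply: ge0_le_integral_nomeas => x x0; first exact: int_Rpos_ge0.
apply: IH => // t t0; apply: FG => i.
by case: (unliftP ord0 i) => [j|] ->; rewrite ?tnthS// tnth0.
Qed.

Lemma integral_expR_pos (a K : R) : (0 < a)%R -> (0 <= K)%R ->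
  \int[@lebesgue_measure R]_(x in [set x : R | (0 < x)%R])
    (K * expR (- (a * x)))%:E <= (K / a)%:E.
Proof.
(* The integrand is [K / a] times the exponential density of rate [a], whose integral is 1. *)
move=> a0 K0; rewrite -[leRHS]mule1 -(integral_exponential_pdf a0).
rewrite -(@ge0_integralZl _ _ _ _ _ measurableT).
- rewrite [leLHS]integral_mkcond; apply: ge0_le_integral_nomeas => x _.
    by rewrite /patch; case: ifPn => // _; rewrite lee_fin mulr_ge0// expR_ge0.
  rewrite /exponential_pdf /patch; case: ifPn => [/[!inE]/= x0|_].
    rewrite mem_set/=; last by rewrite in_itv/= ltW.
    by rewrite -EFinM lee_fin mulNr mulrA divfK// gt_eqF.
  case: ifPn => _; rewrite -?EFinM ?lee_fin ?mulr0//.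
  by rewrite mulr_ge0 ?divr_ge0 ?mulr_ge0 ?expR_ge0 ?(ltW a0).
- by apply/measurable_EFinP; exact: measurable_exponential_pdf.
- by move=> x _; rewrite lee_fin; apply: exponential_pdf_ge0; exact: ltW.
- by rewrite lee_fin divr_ge0 ?(ltW a0).
Qed.

(** Each coordinate contributes a factor [1 / a]. The induction generalises [K], which absorbs the
    factor [expR (- (a * x))] of the outer coordinate. *)
Lemma int_Rpos_expR_le k (a K : R) : (0 < a)%R -> (0 <= K)%R ->
  int_Rpos (fun t : k.-tuple R => (K * expR (- (a * \sum_j tnth t j)))%:E)
    <= (K / a ^+ k)%:E.
Proof.
move=> a0; elim: k K => [|k IH] K K0 /=.
  by rewrite big_ord0 mulr0 oppr0 expR0 expr0 mulr1 divr1.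
have := integral_expR_pos a0 (divr_ge0 K0 (exprn_ge0 k (ltW a0))).
rewrite -mulrA -invfM -exprSr; apply: le_trans.
apply: ge0_le_integral_nomeas => x /= x0.
  by apply: int_Rpos_ge0 => t; rewrite lee_fin mulr_ge0// expR_ge0.
have /IH := mulr_ge0 K0 (expR_ge0 (- (a * x))).
rewrite mulrAC; apply: le_trans; apply: le_int_Rpos => t.
  by rewrite lee_fin mulr_ge0// expR_ge0.
move=> _; rewrite lee_fin big_ord_recl tnth0 mulrDr opprD expRD mulrA.
by under eq_bigr do rewrite tnthS.
Qed.

Lemma int_Rpos_expR_gt0 k (b : 'I_k -> R) (K : R) : (0 < K)%R ->
  0 < int_Rpos (fun t : k.-tuple R => (K * expR (\sum_j tnth t j * b j))%:E).
Proof.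
elim: k b K => [|k IH] b K K0 /=; first by rewrite lte_fin mulr_gt0// expR_gt0.
(* The outer integral is restricted to []0, 1[], of mass 1. There [x * b ord0] is at least
   [- |b ord0|], whatever the sign of the coefficient. *)
have K'0 : (0 < K * expR (- `|b ord0|))%R by rewrite mulr_gt0// expR_gt0.
have := IH (fun j => b (lift ord0 j)) _ K'0.
set I := (X in 0 < X) => I0.
apply: (@lt_le_trans _ _ (I * lebesgue_measure `]0%R, 1%R[)).
  by rewrite lebesgue_measure_itv/= lte_fin ltr01 oppr0 adde0 mule1.
apply: cst_mul_measure_le_integral => //.
- by move=> x /=; rewrite in_itv/= => /andP[].
- by move=> x _; apply: int_Rpos_ge0 => t; rewrite lee_fin mulr_ge0 ?expR_ge0 ?ltW.
- exact: ltW.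
move=> x /=; rewrite in_itv/= => /andP[x0 x1]; apply: le_int_Rpos => t.
  by rewrite lee_fin mulr_ge0 ?expR_ge0 ?ltW.
move=> _; rewrite lee_fin -!mulrA ler_pM2l// -expRD ler_expR big_ord_recl tnth0.
under [in leRHS]eq_bigr do rewrite tnthS.
rewrite lerD2r lerNl (le_trans (ler_norm _))// normrN normrM.
by rewrite ler_piMl// gtr0_norm// ltW.
Qed.

(** Dropping the nonnegative term in the first coordinate leaves a positive constant [I] integrated
    over a half-line. The other coefficients may have any sign. *)
Lemma int_Rpos_expR_pinfty k (b : 'I_k.+1 -> R) (K : R) : (0 < K)%R ->
  (0 <= b ord0)%R ->
  int_Rpos (fun t : k.+1.-tuple R => (K * expR (\sum_j tnth t j * b j))%:E)
    = +oo.
Proof.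
move=> K0 b0 /=; apply/eqP; rewrite -leye_eq.
have := int_Rpos_expR_gt0 (fun j => b (lift ord0 j)) K0.
set I := (X in 0 < X) => I0.
apply: (@le_trans _ _ (I * lebesgue_measure `]0%R, +oo[)).
  by rewrite lebesgue_measure_itv/= ltry /= addye // gt0_muley.
apply: cst_mul_measure_le_integral => //.
- by move=> x /=; rewrite in_itv/= => /andP[].
- by move=> x _; apply: int_Rpos_ge0 => t; rewrite lee_fin mulr_ge0 ?expR_ge0 ?ltW.
- exact: ltW.
move=> x /=; rewrite in_itv/= andbT => x0; apply: le_int_Rpos => t.
  by rewrite lee_fin mulr_ge0 ?expR_ge0 ?ltW.
move=> _; rewrite lee_fin ler_pM2l// ler_expR big_ord_recl tnth0.
under [in leRHS]eq_bigr do rewrite tnthS.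
by rewrite lerDr mulr_ge0// ltW.
Qed.

End int_Rpos_bounds.

(** * The Stiefel manifold and its Haar measure *)

Section matrix_measurability.
Context (R : realType) (n p : nat).

Lemma measurable_entry (i : 'I_n) (j : 'I_p) :
  measurable_fun setT (fun X : mxm R n p => (X : 'M[R]_(n, p)) i j).
Proof.
have -> : (fun X : mxm R n p => (X : 'M[R]_(n, p)) i j) =
    mx_entry (mxvec_index i j).
  by apply/funext => X; rewrite /mx_entry mxvecE.
move=> _ B mB; apply: sub_sigma_algebra; rewrite (bigD1 (mxvec_index i j))//=.
by left; exists B.
Qed.

Lemma measurable_mulmx_entry (Q : 'M[R]_n) (i : 'I_n) (j : 'I_p) :
  measurable_fun setT (fun X : mxm R n p => (Q *m (X : 'M[R]_(n, p))) i j).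
Proof.
under eq_fun do rewrite mxE; apply: measurable_sum => k.
by apply: measurable_funM => //; exact: measurable_entry.
Qed.

(** Writing the matrix equation as one vanishing sum of squares makes the manifold the zero set of a
    single polynomial in the entries, hence measurable. *)
Lemma stiefelP (X : 'M[R]_(n, p)) : stiefel X <->
  \sum_i \sum_j ((X^T *m X) i j - (i == j)%:R) ^+ 2 = 0.
Proof.
have sq0 i j : 0 <= ((X^T *m X) i j - (i == j)%:R) ^+ 2 by exact: sqr_ge0.
have row0 i : 0 <= \sum_j ((X^T *m X) i j - (i == j)%:R) ^+ 2.
  by apply: sumr_ge0.
split=> [XX|/psumr_eq0P XX].
  by rewrite big1 // => i _; rewrite big1 // => j _; rewrite XX mxE subrr expr0n.
apply/matrixP => i j; have /psumr_eq0P := XX (fun i _ => row0 i) i isT.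
move=> /(_ (fun j _ => sq0 i j) j isT)/eqP; rewrite sqrf_eq0 subr_eq0 => /eqP ->.
by rewrite mxE.
Qed.

Lemma measurable_stiefel : measurable (@stiefel R n p).
Proof.
pose f (X : mxm R n p) : R := \sum_i \sum_j
  (((X : 'M[R]_(n, p))^T *m (X : 'M[R]_(n, p))) i j - (i == j)%:R) ^+ 2.
have -> : @stiefel R n p = f @^-1` [set 0].
  by apply/seteqP; split => X /stiefelP.
have mf : measurable_fun setT f.
  apply: measurable_sum => i; apply: measurable_sum => j.
  apply: measurable_funX; apply: measurable_funB => //.
  under eq_fun do rewrite mxE; apply: measurable_sum => k.
  under eq_fun do rewrite mxE.
  by apply: measurable_funM; exact: measurable_entry.
by rewrite -[X in measurable X]setTI; exact: mf.
Qed.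

(** With [Q = 1%:M] this is an entrywise neighbourhood of [A] in the manifold. For orthogonal [Q] it
    is the preimage of that neighbourhood under left multiplication by [Q]. *)
Definition stiefel_box (Q : 'M[R]_n) (A : 'M[R]_(n, p)) (e : R)
  : set (mxm R n p) :=
  [set X | stiefel X /\
    forall i j, `|(Q *m (X : 'M[R]_(n, p))) i j - A i j| < e].

Lemma measurable_stiefel_box Q A e : measurable (stiefel_box Q A e).
Proof.
have -> : stiefel_box Q A e = @stiefel R n p `&` \bigcap_(ij : 'I_n * 'I_p)
    [set X : mxm R n p |
      (fun X : mxm R n p => (Q *m (X : 'M[R]_(n, p))) ij.1 ij.2) X
        \in `]A ij.1 ij.2 - e, A ij.1 ij.2 + e[].
  apply/seteqP; split=> X /= [VX bX]; split=> //.
    by move=> [i j] _ /=; rewrite in_itv/= -ltr_distl.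
  by move=> i j; have := bX (i, j) I; rewrite /= in_itv/= -ltr_distl.
apply: measurableI; first exact: measurable_stiefel.
apply: fin_bigcap_measurable; first exact: finite_finset.
move=> [i j] _ /=; rewrite -[X in measurable X]setTI.
exact: (measurable_mulmx_entry Q i j measurableT (measurable_itv _)).
Qed.

End matrix_measurability.

(** * Transitivity of the orthogonal group on the Stiefel manifold *)

Section householder.
Context (R : realType).

Lemma trmul_self_eq0 n (w : 'cV[R]_n) : (w^T *m w) 0 0 = 0 -> w = 0.
Proof.
rewrite mxE => /psumr_eq0P w0; apply/matrixP => i j; rewrite ord1 [RHS]mxE.
have := w0 _ i isT; rewrite !mxE -expr2 => w0i.
by apply/eqP; rewrite -sqrf_eq0 w0i // => k _; rewrite mxE -expr2 sqr_ge0.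
Qed.

(* The Householder reflection in the hyperplane orthogonal to [c - e]. *)
Lemma exists_reflection n (c e : 'cV[R]_n) : c^T *m c = 1%:M -> e^T *m e = 1%:M ->
  exists2 H : 'M[R]_n, orthogonal_mx H & H *m c = e /\
    forall y : 'cV[R]_n, c^T *m y = 0 -> e^T *m y = 0 -> H *m y = y.
Proof.
move=> cc ee; set w := c - e; set a := (w^T *m w) 0 0.
have [a0|a0] := eqVneq a 0.
  have /eqP := trmul_self_eq0 a0; rewrite subr_eq0 => /eqP <-.
  by exists 1%:M; [rewrite /orthogonal_mx trmx1 mul1mx|split=> *; rewrite mul1mx].
have wwE : w^T *m w = a%:M by rewrite [LHS]mx11_scalar.
pose H : 'M[R]_n := 1%:M - (2 / a) *: (w *m w^T).
have wT : w^T = c^T - e^T by rewrite /w linearB.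
have HT : H^T = H by rewrite /H linearB/= linearZ/= trmx_mul trmxK trmx1.
have HE (y : 'cV[R]_n) : H *m y = y - (2 / a) *: (w *m (w^T *m y)).
  by rewrite mulmxBl mul1mx -scalemxAl mulmxA.
have ecE : e^T *m c = c^T *m e.
  by rewrite [LHS]mx11_scalar [RHS]mx11_scalar -[e^T *m c]trmxK trmx_mul trmxK mxE.
exists H.
  have Hw : H *m w = - w.
    rewrite HE wwE mul_mx_scalar scalerA divfK// scaler_nat mulr2n opprD addrA.
    by rewrite subrr add0r.
  rewrite /orthogonal_mx HT {2}/H mulmxBr mulmx1 -scalemxAr mulmxA Hw.
  by rewrite mulNmx scalerN opprK /H subrK.
split=> [|y cy ey].
  (* As [c] and [e] are unit vectors, [w^T w = 2 - 2 c^T e = 2 w^T c]. Hence [H] subtracts exactly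
     [w] from [c], which leaves [e]. *)
  have wcE : w^T *m c = (a / 2)%:M.
    have : w^T *m w = w^T *m c *+ 2.
      rewrite wT [in LHS]/w !mulmxBl !mulmxBr cc ee ecE mulr2n opprB.
      by rewrite [c^T *m e]mx11_scalar.
    rewrite wwE => /matrixP/(_ 0 0); rewrite mulmxnE [X in X = _]mxE eqxx mulr1n.
    by move=> aE; rewrite [LHS]mx11_scalar; congr (_%:M); rewrite aE; lra.
  rewrite HE wcE mul_mx_scalar scalerA.
  by rewrite mulrA divfK// divff ?pnatr_eq0// scale1r /w subKr.
have wy : w^T *m y = 0 by rewrite wT mulmxBl cy ey subr0.
by rewrite HE wy mulmx0 scaler0 subr0.
Qed.

Lemma orthogonal_mulmx n p (Q : 'M[R]_n) (X : 'M[R]_(n, p)) : orthogonal_mx Q ->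
  (stiefel (Q *m X) <-> stiefel X).
Proof.
by move=> QQ; rewrite /stiefel/= trmx_mul mulmxA -[_ *m Q^T *m Q]mulmxA QQ mulmx1.
Qed.

Lemma orthogonal_trmx n (Q : 'M[R]_n) : orthogonal_mx Q -> orthogonal_mx Q^T.
Proof. by rewrite /orthogonal_mx trmxK => /mulmx1C. Qed.

Lemma stiefel_pid_mx n p : (p <= n)%N -> stiefel (pid_mx p : 'M[R]_(n, p)).
Proof.
by move=> pn; rewrite /stiefel/= tr_pid_mx mul_pid_mx minnn (minn_idPr pn) pid_mx_1.
Qed.

(** Columns are moved into place one at a time. The reflection taking the next column to its target
    fixes the columns already placed, since they are orthogonal to both. *)
Lemma stiefel_pid_transitive n p (X : 'M[R]_(n, p)) : (p <= n)%N -> stiefel X ->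
  exists2 Q : 'M[R]_n, orthogonal_mx Q & Q *m X = pid_mx p.
Proof.
move=> pn VX.
suff : forall k, (k <= p)%N -> exists2 Q : 'M[R]_n, orthogonal_mx Q &
    forall j : 'I_p, (j < k)%N -> col j (Q *m X) = col j (pid_mx p).
  move=> /(_ p (leqnn p))[Q oQ QX]; exists Q => //.
  by apply/matrixP => i j; have /colP/(_ i) := QX j (ltn_ord j); rewrite !mxE.
elim=> [_|k IH kp]; first by exists 1%:M => //; rewrite /orthogonal_mx trmx1 mul1mx.
have [Q oQ QX] := IH (ltnW kp); set jk := Ordinal kp.
have VY : stiefel (Q *m X) by apply/orthogonal_mulmx.
have dotE (A B : 'M[R]_(n, p)) i j : (col i A)^T *m col j B = ((A^T *m B) i j)%:M.
  rewrite [LHS]mx11_scalar; congr (_%:M); rewrite !mxE.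
  by apply: eq_bigr => l _; rewrite !mxE.
have E1 := stiefel_pid_mx pn.
have cc : (col jk (Q *m X))^T *m col jk (Q *m X) = 1%:M.
  by rewrite dotE VY mxE eqxx.
have ee : (col jk (pid_mx p : 'M[R]_(n, p)))^T *m col jk (pid_mx p) = 1%:M.
  by rewrite dotE E1 mxE eqxx.
have [H oH [Hc Hy]] := exists_reflection cc ee.
exists (H *m Q).
  by rewrite /orthogonal_mx trmx_mul mulmxA -[_ *m H^T *m H]mulmxA oH mulmx1.
move=> j; rewrite ltnS leq_eqVlt -mulmxA colE -mulmxA -colE => /orP[/eqP jE|jk'].
  by have -> : j = jk by apply/val_inj.
have jkN : (jk == j) = false by apply/eqP => jjk; rewrite -jjk /= ltnn in jk'.
rewrite Hy; first exact: QX.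
  by rewrite dotE VY mxE jkN raddf0.
by rewrite QX// dotE E1 mxE jkN raddf0.
Qed.

Lemma stiefel_transitive n p (X Y : 'M[R]_(n, p)) : (p <= n)%N ->
  stiefel X -> stiefel Y -> exists2 Q : 'M[R]_n, orthogonal_mx Q & Q *m X = Y.
Proof.
move=> pn VX VY; have [P oP PX] := stiefel_pid_transitive pn VX.
have [Q oQ QY] := stiefel_pid_transitive pn VY.
exists (Q^T *m P); last by rewrite -mulmxA PX -QY mulmxA oQ mul1mx.
by apply/orthogonal_mulmx => //; exact: orthogonal_trmx.
Qed.

Lemma stiefel_entry_le1 n p (X : 'M[R]_(n, p)) i j : stiefel X -> `|X i j| <= 1.
Proof.
move=> /matrixP/(_ j j); rewrite !mxE eqxx mulr1n (bigD1 i)//= !mxE -expr2 => Xj.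
rewrite -(@ler_pXn2r _ 2) ?nnegrE// expr1n -normrX ger0_norm ?sqr_ge0//.
rewrite -Xj lerDl; apply: sumr_ge0 => k _; rewrite !mxE -expr2; exact: sqr_ge0.
Qed.

End householder.

(** * Positivity of the Haar measure on boxes *)

Lemma measure_gt0_of_countable_cover d (T : measurableType d) (R : realType)
    (mu : measure T R) (I : countType) (A : set T) (F : I -> set T) :
  (forall i, measurable (F i)) -> measurable A -> A `<=` \bigcup_i F i ->
  (0 < mu A)%E -> exists i, (0 < mu (F i))%E.
Proof.
move=> mF mA AF A0; apply: contrapT => /forallNP F0.
suff : mu A = 0%E by move=> A00; rewrite A00 ltxx in A0.
apply: measure_negligible => //.
(* The cover is reindexed by [nat]; a number that codes no index gives the empty set. *)
pose G (k : nat) := if unpickle k is Some i then F i else set0.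
apply: (@negligibleS _ _ _ _ (\bigcup_k G k)).
  by move=> x /AF[i _ Fix]; exists (pickle i) => //; rewrite /G pickleK.
apply: negligible_bigcup => k; rewrite /G.
case: (unpickle k) => [i|]; last exact: negligible_set0.
exists (F i); split => //; apply/eqP; rewrite eq_le measure_ge0 andbT leNgt.
exact/negP/F0.
Qed.

Section haar.
Context (R : realType) (n p : nat) (mu : probability (mxm R n p) R).
Hypotheses (pn : (p <= n)%N) (hmu : is_haar_stiefel mu).

(* Countably many boxes with rational centres cover the Stiefel manifold, so one
   of them is charged; transitivity and invariance move it into any open box. *)
Lemma haar_stiefel_box_gt0 (A : 'M[R]_(n, p)) (e : R) : stiefel A -> 0 < e ->
  (0 < mu (stiefel_box 1%:M A e))%E.
Proof.
(* Each entry of [Q *m (X - X1)] will be a sum of [n] terms of size at most [2 * del]. The [+ 1]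
   makes the total strictly less than [e] and covers [n = 0]. *)
move=> VA e0; pose del := e / (2 * n%:R + 1).
have n0 : 0 <= n%:R :> R by rewrite ler0n.
have N0 : 0 < 2 * n%:R + 1 :> R by lra.
have del0 : 0 < del by rewrite divr_gt0.
have [q Bq] : exists q : 'M[rat]_(n, p),
    (0 < mu (stiefel_box 1%:M (map_mx ratr q) del))%E.
  apply: (@measure_gt0_of_countable_cover _ _ _ _ _ (@stiefel R n p)).
  - by move=> q; exact: measurable_stiefel_box.
  - exact: measurable_stiefel.
  - move=> X VX.
    have /choice[f fX] : forall ij : 'I_n * 'I_p, exists r : rat,
        `|(X : 'M[R]_(n, p)) ij.1 ij.2 - ratr r| < del.
      move=> [i j]; set x := (X : 'M[R]_(n, p)) i j.
      have [|r] := @rat_in_itvoo R (x - del) (x + del); first lra.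
      by rewrite in_itv/= -ltr_distl distrC => xr; exists r.
    exists (\matrix_(i, j) f (i, j)) => //; split=> // i j.
    by rewrite mul1mx !mxE; exact: (fX (i, j)).
  - have [mu1 _] := hmu.
    by have : (0 < mu (@stiefel R n p))%E by rewrite mu1 lte01.
(* The rational centre [q] need not lie on the manifold, so transitivity is applied to a point [X1]
   of the charged box instead. *)
have [X1 [VX1 BX1]] : exists X, stiefel_box 1%:M (map_mx ratr q) del X.
  apply: contrapT => /forallNP B0.
  suff B00 : stiefel_box 1%:M (map_mx ratr q) del = set0.
    by rewrite B00 measure0 ltxx in Bq.
  by apply/seteqP; split => // X /B0.
have [Q oQ QX1] := stiefel_transitive pn VX1 VA.
have [_ /(_ Q oQ _ (measurable_stiefel_box 1%:M A e)) <-] := hmu.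
have -> : (fun X : mxm R n p => (Q *m (X : 'M[R]_(n, p))) : mxm R n p)
    @^-1` stiefel_box 1%:M A e = stiefel_box Q A e.
  apply/seteqP; split=> X /= [VX BX]; split.
  - exact/(orthogonal_mulmx _ oQ).
  - by move=> i j; have := BX i j; rewrite mul1mx.
  - exact/orthogonal_mulmx.
  - by move=> i j; have := BX i j; rewrite mul1mx.
apply: (lt_le_trans Bq); apply: le_measure; rewrite ?inE;
  [exact: measurable_stiefel_box..|].
move=> X [VX BX]; split => // i j; rewrite -QX1 !mxE -sumrB.
apply: (@le_lt_trans _ _ (\sum_(k < n) 2 * del)).
  apply: (le_trans (ler_norm_sum _ _ _)); apply: ler_sum => k _.
  rewrite -mulrBr normrM -[leRHS]mul1r ler_pM ?(stiefel_entry_le1 _ _ oQ)//.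
  have := BX k j; have := BX1 k j; rewrite !mul1mx !mxE => b1 b2.
  rewrite (le_trans (ler_distD (ratr (q k j)) _ _))// [X in _ + X]distrC; lra.
have <- : del * (2 * n%:R + 1) = e by rewrite divfK ?gt_eqF.
by rewrite sumr_const card_ord -mulr_natl; lra.
Qed.

End haar.

(** * Bounds on the density *)

Section hypergeometric_bounds.
Context (R : realType) (n p : nat) (mu : probability (mxm R n p) R).
Hypothesis pn : (p <= n)%N.

Lemma sum_diagonal (d : p.-tuple R) (X : 'M[R]_(n, p)) :
  \sum_(i < n) \sum_(j < p) (if (i == j :> nat) then tnth d j * X i j else 0) =
  \sum_(j < p) tnth d j * X (widen_ord pn j) j.
Proof.
rewrite exchange_big; apply: eq_bigr => j _.
rewrite (bigD1 (widen_ord pn j))//= eqxx big1 ?addr0// => i.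
by rewrite -val_eqE/= => /negbTE ->.
Qed.

(** Three values of [e] serve later: a small one for convergence, [1] for positivity of [hyp0F1],
    and [0] where only the upper bound is wanted. *)
Lemma hyp0F1_bounds (d : p.-tuple R) (e : R) : (forall j, 0 <= tnth d j) ->
  fine (mu (stiefel_box 1%:M (pid_mx p) e))
    * expR ((1 - e) * \sum_j tnth d j) <= hyp0F1 mu d <= expR (\sum_j tnth d j).
Proof.
move=> d0; rewrite /hyp0F1 /Rintegral.
set I := (\int[mu]_(x in _) _)%E; set B := stiefel_box _ _ _.
have mB : measurable B by exact: measurable_stiefel_box.
have Bfin : (mu B \is a fin_num)%E by exact: fin_num_measure.
have I_le : (I <= (expR (\sum_j tnth d j))%:E)%E.
  rewrite -[leRHS]mule1 -(probability_setT mu); apply: integral_le_cst.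
  - by move=> X _; rewrite lee_fin expR_ge0.
  - by rewrite lee_fin expR_ge0.
  - move=> X VX; rewrite lee_fin ler_expR sum_diagonal; apply: ler_sum => j _.
    rewrite ler_piMr// (le_trans (ler_norm _))//.
    exact: stiefel_entry_le1.
have le_I : ((expR ((1 - e) * \sum_j tnth d j))%:E * mu B <= I)%E.
  apply: cst_mul_measure_le_integral => //.
    by move=> X [].
  move=> X [VX BX]; rewrite lee_fin ler_expR sum_diagonal mulr_sumr.
  apply: ler_sum => j _; rewrite mulrC ler_wpM2l//.
  have := BX (widen_ord pn j) j; rewrite mul1mx mxE/= eqxx ltn_ord/= mulr1n.
  by rewrite ltr_distl => /andP[/ltW].
have I0 : (0 <= I)%E by apply: integral_ge0 => X _; rewrite lee_fin expR_ge0.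
have Ifin : I \is a fin_num by rewrite ge0_fin_numE// (le_lt_trans I_le)// ltry.
by rewrite -!lee_fin EFinM !fineK// [X in (X <= _)%E]muleC le_I.
Qed.

Lemma hyp0F1_gt0 (d : p.-tuple R) : is_haar_stiefel mu ->
  (forall j, 0 <= tnth d j) -> 0 < hyp0F1 mu d.
Proof.
move=> hmu d0; have /andP[h _] := hyp0F1_bounds 1 d0; apply: lt_le_trans h.
rewrite mulr_gt0 ?expR_gt0//; apply: fine_gt0.
rewrite (haar_stiefel_box_gt0 pn hmu (stiefel_pid_mx _ pn) ltr01)/=.
rewrite -ge0_fin_numE ?measure_ge0//; apply: fin_num_measure.
exact: measurable_stiefel_box.
Qed.

End hypergeometric_bounds.

(** * Spectral norm and bilinear forms in Stiefel columns *)

Section spectral_norm.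
Context (R : realType).

Lemma vnorm2_eq1 k (x : 'cV[R]_k) : vnorm2 x = 1 <-> x^T *m x = 1%:M.
Proof.
have E : (x^T *m x) 0 0 = \sum_i x i 0 ^+ 2.
  by rewrite mxE; apply: eq_bigr => i _; rewrite mxE expr2.
have x0 : 0 <= \sum_i x i 0 ^+ 2 by apply: sumr_ge0 => i _; exact: sqr_ge0.
rewrite /vnorm2 -E in x0 *; split => [/(congr1 (fun r => r ^+ 2))|xx].
  by rewrite sqr_sqrtr// expr1n => xx; rewrite [LHS]mx11_scalar xx.
by rewrite xx mxE eqxx mulr1n sqrtr1.
Qed.

Lemma vnorm2_mulmx_le_spec_norm n p (A : 'M[R]_(n, p)) (x : 'cV[R]_p) :
  vnorm2 x = 1 -> vnorm2 (A *m x) <= spec_norm A.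
Proof.
move=> x1; apply: ub_le_sup; last by exists x.
(* The supremum is an upper bound only once the set is known to be bounded. Entries of a unit
   vector, a one-column Stiefel matrix, are at most 1 in absolute value, so row sums of [|A i j|]
   suffice. *)
exists (Num.sqrt (\sum_i (\sum_j `|A i j|) ^+ 2)) => _ [z /= /vnorm2_eq1 z1 <-].
apply: ler_wsqrtr; apply: ler_sum => i _.
rewrite -[leLHS]ger0_norm ?sqr_ge0// normrX lerXn2r ?nnegrE//.
  by apply: sumr_ge0.
rewrite mxE (le_trans (ler_norm_sum _ _ _))//; apply: ler_sum => j _.
by rewrite normrM ler_piMr// stiefel_entry_le1.
Qed.

(** Cauchy-Schwarz: with [s] the dot product, expanding the squared norm of [y - s m] gives
    [|y|^2 - s^2 >= 0]. *)
Lemma dot_le_vnorm2 n (m y : 'cV[R]_n) : vnorm2 m = 1 -> (m^T *m y) 0 0 <= vnorm2 y.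
Proof.
move=> /vnorm2_eq1/matrixP/(_ 0 0); rewrite !mxE eqxx mulr1n.
under eq_bigr do rewrite mxE -expr2; under [in leLHS]eq_bigr do rewrite mxE.
set s := (X in _ -> X <= _) => mm.
have y0 : 0 <= \sum_i y i 0 ^+ 2 by apply: sumr_ge0 => i _; exact: sqr_ge0.
have : 0 <= \sum_i (y i 0 - s * m i 0) ^+ 2.
  by apply: sumr_ge0 => i _; exact: sqr_ge0.
have sqE (r : R) : \sum_i (y i 0 - r * m i 0) ^+ 2 =
    \sum_i y i 0 ^+ 2 - 2 * r * (\sum_i m i 0 * y i 0) + r ^+ 2 * \sum_i m i 0 ^+ 2.
  rewrite !mulr_sumr -sumrB -big_split/=; apply: eq_bigr => i _; ring.
rewrite sqE mm -/s => h; rewrite (le_trans (ler_norm _))// -sqrtr_sqr ler_wsqrtr//.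
by rewrite -subr_ge0; nra.
Qed.

(** The diagonal entry is the dot product of column [j] of [M] with [Psi] applied to column [j] of
    [V], and both columns are unit vectors. *)
Lemma stiefel_quadratic_le_spec_norm n p (Psi M : 'M[R]_(n, p)) (V : 'M[R]_p) j :
  stiefel M -> stiefel V -> (M^T *m Psi *m V) j j <= spec_norm Psi.
Proof.
have colS k (X : 'M[R]_(k, p)) : stiefel X -> vnorm2 (col j X) = 1.
  move=> /matrixP/(_ j j) XX; apply/vnorm2_eq1; rewrite [LHS]mx11_scalar.
  congr (_%:M); rewrite [in RHS]mxE eqxx in XX; rewrite -[RHS]XX !mxE.
  by apply: eq_bigr => i _; rewrite !mxE.
move=> /colS m1 /colS v1.
apply: le_trans (vnorm2_mulmx_le_spec_norm Psi v1).
apply: le_trans (dot_le_vnorm2 _ m1).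
rewrite -mulmxA !mxE le_eqVlt; apply/orP; left; apply/eqP.
apply: eq_bigr => i _; rewrite !mxE; congr (_ * _).
by apply: eq_bigr => k _; rewrite !mxE.
Qed.

(** A reflection taking the first basis vector to [u] is applied to [pid_mx p.+1]. *)
Lemma exists_stiefel_col0 n p (u : 'cV[R]_n) : (p < n)%N -> u^T *m u = 1%:M ->
  exists2 M : 'M[R]_(n, p.+1), stiefel M & col ord0 M = u.
Proof.
move=> pn uu; have E1 := stiefel_pid_mx R pn.
set P : 'M[R]_(n, p.+1) := pid_mx p.+1.
have cc : (col ord0 P)^T *m col ord0 P = 1%:M.
  rewrite [LHS]mx11_scalar; congr (_%:M).
  move: E1 => /matrixP/(_ ord0 ord0); rewrite [in RHS]mxE eqxx mulr1n => <-.
  by rewrite !mxE; apply: eq_bigr => i _; rewrite !mxE.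
have [H oH [Hc _]] := exists_reflection cc uu.
exists (H *m P); first exact/orthogonal_mulmx.
by rewrite colE -mulmxA -colE.
Qed.

End spectral_norm.

(** * Convergence when the spectral norm is below 1 *)

Section total_integral.
Context (R : realType) (n p : nat).
Implicit Types (nu : R) (Psi M : 'M[R]_(n, p)) (V : 'M[R]_p).

Lemma gdensE (mu : probability (mxm R n p) R) nu Psi M d V :
  gdens mu nu Psi M d V =
  expR (\sum_j tnth d j * (nu * (M^T *m Psi *m V) j j)) / hyp0F1 mu d `^ nu.
Proof.
congr (expR _ / _); rewrite mxtraceZ -!mulmxA mxtrace_mulC mulr_sumr.
rewrite -mulmxA mul_diag_mx mulmxA; apply: eq_bigr => j _.
have rowE : (\row_k tnth d k) 0 j = tnth d j by rewrite mxE.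
by rewrite [X in nu * X = _]mxE rowE mulrCA.
Qed.

Context (muM : probability (mxm R n p) R) (muV : probability (mxm R p p) R).
Hypotheses (pn : (p <= n)%N) (hM : is_haar_stiefel muM).

Lemma gdens_ge0 nu Psi M d V : 0 <= gdens muM nu Psi M d V.
Proof. by rewrite divr_ge0 ?expR_ge0 ?powR_ge0. Qed.

Lemma gdens_le nu Psi (e : R) : 0 < nu -> 0 < e -> exists2 K : R, 0 <= K &
  forall M V (d : p.-tuple R), stiefel M -> stiefel V ->
    (forall j, 0 < tnth d j) ->
    gdens muM nu Psi M d V <=
      K * expR (- (nu * (1 - e - spec_norm Psi) * \sum_j tnth d j)).
Proof.
move=> nu0 e0; set c := fine (muM (stiefel_box 1%:M (pid_mx p) e)).
have c0 : 0 < c.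
  apply: fine_gt0; rewrite (haar_stiefel_box_gt0 pn hM (stiefel_pid_mx _ pn) e0)/=.
  rewrite -ge0_fin_numE ?measure_ge0//; apply: fin_num_measure.
  exact: measurable_stiefel_box.
(* This is the box mass from the lower bound on [hyp0F1], raised to the power [- nu]; it depends on
   none of [M], [V], [d]. *)
exists (c `^ nu)^-1; first by rewrite invr_ge0 powR_ge0.
move=> M V d VM VV d0; set S := \sum_j tnth d j.
have /andP[hle _] := hyp0F1_bounds muM pn e (fun j => ltW (d0 j)).
have cS0 : 0 < c * expR ((1 - e) * S) by rewrite mulr_gt0 ?expR_gt0.
have h0 : 0 < hyp0F1 muM d by exact: lt_le_trans hle.
rewrite gdensE ler_pdivrMr ?powR_gt0//.
have : (c * expR ((1 - e) * S)) `^ nu <= hyp0F1 muM d `^ nu.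
  by apply: ge0_ler_powR hle; rewrite ?nnegrE ltW.
have K0 : 0 <= (c `^ nu)^-1 * expR (- (nu * (1 - e - spec_norm Psi) * S)).
  by rewrite mulr_ge0 ?expR_ge0 ?invr_ge0 ?powR_ge0.
move=> /(ler_wpM2l K0); apply: le_trans.
rewrite powRM ?expR_ge0 ?(ltW c0)// -expRM mulrACA mulVf ?gt_eqF ?powR_gt0//.
rewrite mul1r -expRD ler_expR.
have -> : - (nu * (1 - e - spec_norm Psi) * S) + (1 - e) * S * nu =
  \sum_j tnth d j * (nu * spec_norm Psi) by rewrite -mulr_suml -/S; ring.
apply: ler_sum => j _; rewrite ler_pM2l// ler_pM2l//.
exact: stiefel_quadratic_le_spec_norm.
Qed.

Lemma total_integral_lt_pinfty nu Psi : 0 < nu -> spec_norm Psi < 1 ->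
  (total_integral muM muV nu Psi < +oo)%E.
Proof.
(* Half of the gap goes to [e]; the other half leaves the decay rate
   [a = nu * (1 - spec_norm Psi) / 2], which is positive. *)
move=> nu0 s1; set e := (1 - spec_norm Psi) / 2.
have e0 : 0 < e by rewrite divr_gt0// subr_gt0.
have [K K0 gK] := gdens_le Psi nu0 e0.
set a := nu * (1 - e - spec_norm Psi) in gK.
have a0 : 0 < a by rewrite mulr_gt0// /e; lra.
set C := (K / a ^+ p)%:E.
have C0 : (0 <= C)%E by rewrite lee_fin divr_ge0// exprn_ge0// ltW.
have G0 M V : (0 <= int_Rpos (fun d => (gdens muM nu Psi M d V)%:E))%E.
  by apply: int_Rpos_ge0 => d; rewrite lee_fin gdens_ge0.
apply: (@le_lt_trans _ _ C); last exact: ltry.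
rewrite -[leRHS]mule1 -(probability_setT muM); apply: integral_le_cst => //.
  by move=> M _; apply: integral_ge0 => V _.
move=> M VM.
rewrite -[leRHS]mule1 -(probability_setT muV); apply: integral_le_cst => //.
move=> V VV; apply: le_trans (int_Rpos_expR_le p a0 K0).
apply: le_int_Rpos => d; first by rewrite lee_fin gdens_ge0.
by move=> d0; rewrite lee_fin gK.
Qed.

End total_integral.

(** * Divergence when the spectral norm exceeds 1 *)

Section divergence.
Context (R : realType) (n p : nat).
Implicit Types (nu : R) (Psi M : 'M[R]_(n, p.+1)) (V : 'M[R]_p.+1).
Context (muM : probability (mxm R n p.+1) R) (muV : probability (mxm R p.+1 p.+1) R).
Hypotheses (pn : (p.+1 <= n)%N) (hM : is_haar_stiefel muM)
  (hV : is_haar_stiefel muV).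

(** Bounding [hyp0F1] above by the exponential of the sum of the [d_j] subtracts 1 from every
    diagonal entry in the exponent, and the first one stays nonnegative. *)
Lemma int_Rpos_gdens_pinfty nu Psi M V : 0 < nu ->
  1 <= (M^T *m Psi *m V) ord0 ord0 ->
  int_Rpos (fun d => (gdens muM nu Psi M d V)%:E) = +oo%E.
Proof.
move=> nu0 N1; pose b j := nu * ((M^T *m Psi *m V) j j - 1).
have b0 : 0 <= b ord0 by rewrite mulr_ge0 ?subr_ge0 ?(ltW nu0).
apply/eqP; rewrite -leye_eq -(int_Rpos_expR_pinfty (K := 1) ltr01 b0).
apply: le_int_Rpos => d; first by rewrite lee_fin mul1r; exact: expR_ge0.
move=> d0; have d0' j := ltW (d0 j).
have /andP[_ hle] := hyp0F1_bounds muM pn 0 d0'.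
have h0 := hyp0F1_gt0 pn hM d0'.
rewrite lee_fin mul1r gdensE ler_pdivlMr ?powR_gt0//.
have /(ler_wpM2l (expR_ge0 (\sum_j tnth d j * b j))) :
    hyp0F1 muM d `^ nu <= expR (\sum_j tnth d j) `^ nu.
  by apply: ge0_ler_powR hle; rewrite ?nnegrE ?expR_ge0 ?ltW.
move=> /le_trans; apply; rewrite -expRM -expRD ler_expR mulr_suml -big_split/=.
by apply: ler_sum => j _; rewrite /b mulrBr mulrBr mulr1 subrK.
Qed.

Lemma stiefel_box_quadratic_ge1 Psi M0 V0 :
  stiefel M0 -> stiefel V0 -> 1 < (M0^T *m Psi *m V0) ord0 ord0 ->
  exists2 e : R, 0 < e & forall M V, stiefel_box 1%:M M0 e M ->
    stiefel_box 1%:M V0 e V -> 1 <= (M^T *m Psi *m V) ord0 ord0.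
Proof.
have qE M V : (M^T *m Psi *m V) ord0 ord0 =
    \sum_k \sum_i M i ord0 * Psi i k * V k ord0.
  rewrite mxE; apply: eq_bigr => k _; rewrite mxE mulr_suml.
  by apply: eq_bigr => i _; rewrite mxE.
move=> VM0 VV0; set r := (_ *m _) ord0 ord0 => r1.
pose S := \sum_k \sum_i `|Psi i k|.
have S0 : 0 <= S by apply: sumr_ge0 => k _; apply: sumr_ge0.
have D0 : 0 < 2 * S + 1 by lra.
(* Moving both matrices within their boxes changes the entry by at most [2 * e * S], which is less
   than [r - 1]. The [+ 1] guards against [S = 0]. *)
pose e := (r - 1) / (2 * S + 1).
have e0 : 0 < e by rewrite divr_gt0// subr_gt0.
exists e => // M V [VM BM] [VV BV].
have : `|(M^T *m Psi *m V) ord0 ord0 - r| <= 2 * e * S.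
  rewrite /r !qE -sumrB mulr_sumr (le_trans (ler_norm_sum _ _ _))//.
  apply: ler_sum => k _; rewrite -sumrB mulr_sumr (le_trans (ler_norm_sum _ _ _))//.
  apply: ler_sum => i _.
  have -> : M i ord0 * Psi i k * V k ord0 - M0 i ord0 * Psi i k * V0 k ord0 =
    ((M i ord0 - M0 i ord0) * V k ord0 + M0 i ord0 * (V k ord0 - V0 k ord0))
      * Psi i k by ring.
  rewrite normrM ler_wpM2r// (le_trans (ler_normD _ _))// !normrM.
  rewrite mulr2n mulrDl mul1r lerD//.
    rewrite -[leRHS]mulr1 ler_pM ?(stiefel_entry_le1 _ _ VV)//.
    by have := BM i ord0; rewrite mul1mx => /ltW.
  rewrite -[leRHS]mul1r ler_pM ?(stiefel_entry_le1 _ _ VM0)//.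
  by have := BV k ord0; rewrite mul1mx => /ltW.
rewrite ler_distl => /andP[+ _].
have : e * (2 * S + 1) = r - 1 by rewrite divfK ?gt_eqF.
by move: e0 => /=; lra.
Qed.

Lemma exists_stiefel_quadratic_gt1 Psi : 1 < spec_norm Psi ->
  exists M0 V0, [/\ stiefel M0, stiefel V0 & 1 < (M0^T *m Psi *m V0) ord0 ord0].
Proof.
move=> s1.
have [] := @sup_gt R _ 1 _ s1.
  (* An empty set of values would have supremum 0 by convention, contradicting [s1]. *)
  apply: contrapT => /nonemptyPn E; move: s1; rewrite /spec_norm E sup0.
  by rewrite ltNge ler01.
move=> _ [v /= /vnorm2_eq1 vv <-]; set y := Psi *m v; set r := vnorm2 y => r1.
have r0 : r != 0 by rewrite gt_eqF// (lt_trans ltr01).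
have yy : y^T *m y = (r ^+ 2)%:M.
  rewrite [LHS]mx11_scalar /r sqr_sqrtr; last first.
    by apply: sumr_ge0 => i _; exact: sqr_ge0.
  by congr (_%:M); rewrite mxE; apply: eq_bigr => i _; rewrite mxE expr2.
have uT : (r^-1 *: y)^T = r^-1 *: y^T by rewrite linearZ.
have uu : (r^-1 *: y)^T *m (r^-1 *: y) = 1%:M.
  rewrite uT -scalemxAl -scalemxAr yy scalerA scale_scalar_mx.
  by rewrite -expr2 -exprMn mulVf// expr1n.
have [M0 VM0 Mu] := exists_stiefel_col0 pn uu.
have [V0 VV0 Vv] := exists_stiefel_col0 (ltnSn p) vv.
exists M0, V0; split=> //.
have -> : (M0^T *m Psi *m V0) ord0 ord0 =
    ((col ord0 M0)^T *m (Psi *m col ord0 V0)) 0 0.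
  rewrite -mulmxA !mxE; apply: eq_bigr => i _; rewrite !mxE; congr (_ * _).
  by apply: eq_bigr => k _; rewrite !mxE.
rewrite Mu Vv -/y uT -scalemxAl yy scale_scalar_mx mxE eqxx mulr1n.
by rewrite expr2 mulKf.
Qed.

Lemma total_integral_pinfty nu Psi : 0 < nu -> 1 < spec_norm Psi ->
  total_integral muM muV nu Psi = +oo%E.
Proof.
move=> nu0 /exists_stiefel_quadratic_gt1[M0 [V0 [VM0 VV0 q1]]].
have [e e0 qe] := stiefel_box_quadratic_ge1 VM0 VV0 q1.
have G0 M V : (0 <= int_Rpos (fun d => (gdens muM nu Psi M d V)%:E))%E.
  by apply: int_Rpos_ge0 => d; rewrite lee_fin gdens_ge0.
apply/eqP; rewrite -leye_eq.
(* The value [+oo] equals [+oo] times the positive mass of the box around [M0]. The same device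
   around [V0] then handles the inner integral. *)
rewrite -(gt0_mulye (haar_stiefel_box_gt0 pn hM VM0 e0)).
apply: cst_mul_measure_le_integral => //.
- exact: measurable_stiefel_box.
- by move=> M [].
- by move=> M _; apply: integral_ge0 => V _.
move=> M BM; rewrite -(gt0_mulye (haar_stiefel_box_gt0 (leqnn _) hV VV0 e0)).
apply: cst_mul_measure_le_integral => //.
- exact: measurable_stiefel_box.
- by move=> V [].
move=> V BV; rewrite leye_eq; apply/eqP; apply: int_Rpos_gdens_pinfty => //.
exact: qe.
Qed.

End divergence.

Unset Implicit Arguments.

Theorem theorem1 (R : realType) (n p : nat) (hnp : (p <= n)%N)
    (nu : R) (hnu : 0 < nu) (Psi : 'M[R]_(n, p))
    (muM : probability (mxm R n p) R) (muV : probability (mxm R p p) R)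
    (hM : is_haar_stiefel muM) (hV : is_haar_stiefel muV) :
  (spec_norm Psi < 1 -> (total_integral muM muV nu Psi < +oo)%E) /\
  (1 < spec_norm Psi -> total_integral muM muV nu Psi = +oo%E).
Proof.
split; first exact: total_integral_lt_pinfty.
(* For [p = 0] there is no unit vector, so [spec_norm Psi] is the supremum of the empty set, which
   is 0, and the premise is absurd. *)
case: p hnp Psi muM muV hM hV => [|p] hnp Psi muM muV hM hV.
  suff -> : spec_norm Psi = 0 by rewrite ltNge ler01.
  rewrite /spec_norm (_ : [set _ | _ in _] = set0) ?sup0//.
  apply/seteqP; split=> // _ [x /= + _]; rewrite /vnorm2 big_ord0 sqrtr0.
  by move/eqP; rewrite eq_sym oner_eq0.
exact: total_integral_pinfty.
Qed.
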